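(* Let $F$ be a field and let $A$ be a unital commutative associative $F$-algebra. Let $\Gamma(A)=A\oplus A^2$ with grading $\Gamma(A)_0=A$, $\Gamma(A)_1=A^2=\{(a,b):a,b\in A\}$ and multiplication extending that of $A$ by $$a\cdot(b,c)=(b,c)\cdot a=(ab,ac),\qquad (a,b)\cdot(c,d)=ad-bc,\qquad a,b,c,d\in A.$$ Then $\Gamma(A)$ is a $\Gamma$-algebra, and it is a Jordan superalgebra.
   Context: Algebras are not assumed associative; $[a,b]=ab-ba$, $(a,b,c)=(ab)c-a(bc)$, and $Z(\cdot)$ denotes the center. A $\Gamma$-algebra is a $\mathbb Z_2$-graded $F$-algebra $\Gamma=\Gamma_0\oplus\Gamma_1$ such that: (i) $\Gamma_0$ is a unital associative algebra, $[\Gamma_0,\Gamma_1]=0$ and $(\Gamma_0,\Gamma,\Gamma)=0$ (associators whose first entry is in $\Gamma_0$ vanish); (ii) $\Gamma_1^2\subseteq Z(\Gamma_0)$; (iii) $xy+yx=0$ for $x,y\in\Gamma_1$; (iv) $(xy)z+(yz)x+(zx)y=0$ for $x,y,z\in\Gamma_1$. A superalgebra ($\mathbb Z_2$-graded algebra) $J=J_0\oplus J_1$, with $\bar x=i$ for $x\in J_i$, is commutative (as a superalgebra) if $xy=(-1)^{\bar x\bar y}yx$ for homogeneous $x,y$. A commutative superalgebra is called a Jordan superalgebra if for all homogeneous $x,y,z,t$ $$(xy,z,t)+(-1)^{\bar y\bar z+\bar y\bar t+\bar z\bar t}(xt,z,y)+(-1)^{\bar x(\bar y+\bar z+\bar t)+\bar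 z\bar t}(yt,z,x)=0.$$ *)

(* Defs.v *)
From mathcomp Require Import all_boot all_algebra.

Set Implicit Arguments.
Unset Strict Implicit.
Unset Printing Implicit Defensive.

Import GRing.Theory.
Local Open Scope ring_scope.

(* A not necessarily associative F-algebra is an F-module V together with a
   bilinear product mul; a Z_2-grading of V is given by its homogeneous
   components gr false (even) and gr true (odd), with Z_2 = (bool, addb). *)

Section Superalgebras.
Variables (F : fieldType) (V : lmodType F) (mul : V -> V -> V).

Definition commutator (a b : V) : V := mul a b - mul b a.

Definition associator (a b c : V) : V := mul (mul a b) c - mul a (mul b c).

(* The center (commuting and associating elements) of a subalgebra S. *)
Definition in_center (S : {pred V}) (z : V) : Prop :=
  [/\ z \in S,
      {in S, forall x, commutator z x = 0}
    & {in S &, forall x y,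
        [/\ associator z x y = 0, associator x z y = 0
          & associator x y z = 0]}].

(* The additive span of the products of two elements of S; this is a subspace
   as soon as S is one, because mul is bilinear. *)
Definition in_square (S : {pred V}) (v : V) : Prop :=
  exists2 s : seq (V * V),
    all (fun p => (p.1 \in S) && (p.2 \in S)) s
  & v = \sum_(p <- s) mul p.1 p.2.

Record is_superalgebra (gr : bool -> {pred V}) : Prop := IsSuperalgebra {
  salg_linearl : forall y, linear (mul^~ y);
  salg_linearr : forall x, linear (mul x);
  salg_submod  : forall i, submod_closed (gr i);
  salg_direct  : forall v, exists! p : V * V,
    [/\ p.1 \in gr false, p.2 \in gr true & v = p.1 + p.2];
  salg_graded  : forall i j x y,
    x \in gr i -> y \in gr j -> mul x y \in gr (i (+) j)
}.

Record is_Gamma_algebra (gr : bool -> {pred V}) : Prop := IsGammaAlgebra {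
  Gamma_superalgebra : is_superalgebra gr;
  Gamma_unital : exists2 e, e \in gr false
    & {in gr false, forall x, mul e x = x /\ mul x e = x};
  Gamma_assoc : {in gr false & &, forall x y z, associator x y z = 0};
  Gamma_comm : forall x y,
    x \in gr false -> y \in gr true -> commutator x y = 0;
  Gamma_nucl : forall x y z, x \in gr false -> associator x y z = 0;
  Gamma_square : forall v, in_square (gr true) v -> in_center (gr false) v;
  Gamma_anticomm : {in gr true &, forall x y, mul x y + mul y x = 0};
  Gamma_cyclic : {in gr true & &, forall x y z,
    mul (mul x y) z + mul (mul y z) x + mul (mul z x) y = 0}
}.

Record is_commutative_superalgebra (gr : bool -> {pred V}) : Prop :=
  IsCommutativeSuperalgebra {
  csalg_superalgebra : is_superalgebra gr;
  csalg_supercomm : forall (i j : bool) x y,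
    x \in gr i -> y \in gr j ->
    mul x y = (-1) ^+ (i * j)%N *: mul y x
}.

Record is_Jordan_superalgebra (gr : bool -> {pred V}) : Prop :=
  IsJordanSuperalgebra {
  Jordan_commutative : is_commutative_superalgebra gr;
  Jordan_identity : forall (i j k l : bool) x y z t,
    x \in gr i -> y \in gr j -> z \in gr k -> t \in gr l ->
    associator (mul x y) z t
    + (-1) ^+ (j * k + j * l + k * l)%N *: associator (mul x t) z y
    + (-1) ^+ (i * (j + k + l) + k * l)%N *: associator (mul y t) z x = 0
}.

End Superalgebras.

Section GammaOfAlgebra.
Variables (F : fieldType) (A : comAlgType F).

(* (a, (b, c)) stands for the sum of a in the even part A and of (b, c) in the
   odd part A^2. *)
Definition Gamma : lmodType F := (A * (A * A))%type.

Definition Gamma_gr (i : bool) : {pred Gamma} :=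
  [pred v : Gamma | if i then v.1 == 0 else v.2 == 0].

Definition Gamma_act (a : A) (u : A * A) : A * A := (a * u.1, a * u.2).

Definition Gamma_det (u v : A * A) : A := u.1 * v.2 - u.2 * v.1.

Definition Gamma_mul (x y : Gamma) : Gamma :=
  (x.1 * y.1 + Gamma_det x.2 y.2, Gamma_act x.1 y.2 + Gamma_act y.1 x.2).

(* The values on homogeneous elements, which determine Gamma_mul. *)

Lemma Gamma_mul_even_even (a b : A) :
  Gamma_mul (a, 0) (b, 0) = (a * b, 0).
Proof.
by rewrite /Gamma_mul /Gamma_act /Gamma_det /= !mulr0 subr0 !addr0.
Qed.

Lemma Gamma_mul_even_odd (a b c : A) :
  Gamma_mul (a, 0) (0, (b, c)) = (0, (a * b, a * c)).
Proof.
by rewrite /Gamma_mul /Gamma_act /Gamma_det /= !(mulr0, mul0r) subr0 !addr0.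
Qed.

Lemma Gamma_mul_odd_even (a b c : A) :
  Gamma_mul (0, (b, c)) (a, 0) = (0, (a * b, a * c)).
Proof.
by rewrite /Gamma_mul /Gamma_act /Gamma_det /= !(mulr0, mul0r) subr0 add0r add0r.
Qed.

Lemma Gamma_mul_odd_odd (a b c d : A) :
  Gamma_mul (0, (a, b)) (0, (c, d)) = (a * d - b * c, 0).
Proof.
by rewrite /Gamma_mul /Gamma_act /Gamma_det /= !(mulr0, mul0r) add0r addr0.
Qed.

End GammaOfAlgebra.

(* Main.v *)
Require Import Defs.
From mathcomp Require Import all_boot all_algebra.
From mathcomp Require Import ring.

(** Write [<u, v>] for the determinant form on [A^2] and [x = x0 + x1] for the
    decomposition of an element into its even and odd parts. Both the action of
    [A] on [A^2] and the form are [A]-bilinear, so an associator with at least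
    one even entry vanishes, and by trilinearity
    [(x, y, z) = <x1, y1> z1 - <y1, z1> x1] for all [x, y, z]
    ([Gamma_associatorE]). The axioms of a Gamma-algebra follow at once: the
    form is alternating, and (iv) is the identity
    [<u, v> w + <v, w> u + <w, u> v = 0] that holds for three vectors of a free
    module of rank 2.

    The formula shows moreover that the associator is symmetric in its first
    and last entries ([Gamma_associatorC]) and linear over [A] in its first
    entry. The odd part of [xy] is [x0 y1 + y0 x1], so the left-hand side of
    the Jordan identity, with signs [s] and [s'], is
    [x0 ((y, z, t) + s (t, z, y)) + y0 ((x, z, t) + s' (t, z, x))
     + t0 (s (x, z, y) + s' (y, z, x))].
    A summand can be nonzero only if the three entries of its associators are
    odd and the remaining variable is even. In that case the two signs that
    occur in it are opposite to each other, and the symmetry of the associator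
    makes it vanish. *)

Set Implicit Arguments.
Unset Strict Implicit.
Unset Printing Implicit Defensive.

Import GRing.Theory.
Local Open Scope ring_scope.

Section GammaTheory.
Variables (F : fieldType) (A : comAlgType F).
Local Notation G := (Gamma A).
Local Notation mul := (@Gamma_mul F A).
Local Notation gr := (@Gamma_gr F A).
Local Notation assoc := (associator mul).

Implicit Types (x y z t : G).

Lemma Gamma_evenP x : reflect (x.2 = 0) (x \in gr false).
Proof. exact: eqP. Qed.

Lemma Gamma_oddP x : reflect (x.1 = 0) (x \in gr true).
Proof. exact: eqP. Qed.

Lemma Gamma_eqP x y :
  x.1 = y.1 -> x.2.1 = y.2.1 -> x.2.2 = y.2.2 -> x = y.
Proof. by case: x y => [a [b c]] [a' [b' c']] /= -> -> ->. Qed.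

Lemma Gamma_associatorE x y z :
  assoc x y z = (0, Gamma_act (Gamma_det x.2 y.2) z.2
                    - Gamma_act (Gamma_det y.2 z.2) x.2).
Proof.
by apply: Gamma_eqP; rewrite /associator /Gamma_mul /Gamma_act /Gamma_det /=;
   ring.
Qed.

Lemma Gamma_associatorC x y z : assoc x y z = assoc z y x.
Proof.
by rewrite !Gamma_associatorE; apply: Gamma_eqP; rewrite //= /Gamma_det; ring.
Qed.

(** Each of the two terms of the associator formula has one factor from every
    entry's odd part. *)
Lemma Gamma_associator_even x y z :
  [|| x \in gr false, y \in gr false | z \in gr false] -> assoc x y z = 0.
Proof.
rewrite Gamma_associatorE => /or3P[] /Gamma_evenP ->;
  by apply: Gamma_eqP; rewrite //= /Gamma_det /=; ring.
Qed.

(** Linearity over [A], and not only over [F], of the associator in its first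
    entry, in the form in which a product enters the Jordan identity. *)
Lemma Gamma_associator_mull x y z t :
  assoc (mul x y) z t =
    mul (x.1, 0) (assoc y z t) + mul (y.1, 0) (assoc x z t).
Proof.
rewrite !Gamma_associatorE /Gamma_mul /Gamma_act /Gamma_det.
by apply: Gamma_eqP => /=; ring.
Qed.

Lemma Gamma_mulC_even x y : x \in gr false -> mul x y = mul y x.
Proof.
move=> /Gamma_evenP x0; rewrite /Gamma_mul /Gamma_act /Gamma_det x0.
by apply: Gamma_eqP => /=; ring.
Qed.

(** Scaling by [k] in [F] is turned into multiplication by [k *: 1] in [A], so
    that linearity becomes an identity between polynomials over [A]. *)
Lemma Gamma_mul_linearl y : linear (mul^~ y).
Proof.
move=> k u v; apply: Gamma_eqP;
  rewrite /= /Gamma_det /=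
    -?(mulr_algl k u.1) -?(mulr_algl k u.2.1) -?(mulr_algl k u.2.2)
    -?(mulr_algl k (_ + _)) -?(mulr_algl k (_ - _)); ring.
Qed.

Lemma Gamma_mul_linearr x : linear (mul x).
Proof.
move=> k u v; apply: Gamma_eqP;
  rewrite /= /Gamma_det /=
    -?(mulr_algl k u.1) -?(mulr_algl k u.2.1) -?(mulr_algl k u.2.2)
    -?(mulr_algl k (_ + _)) -?(mulr_algl k (_ - _)); ring.
Qed.

Lemma Gamma_mul_graded (i j : bool) x y :
  x \in gr i -> y \in gr j -> mul x y \in gr (i (+) j).
Proof.
case: i j => [] [] /eqP /= x0 /eqP /= y0; apply/eqP => /=;
  rewrite /Gamma_act /Gamma_det x0 y0 ?(mul0r, mulr0, addr0, subr0) //.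
Qed.

Lemma Gamma_is_superalgebra : is_superalgebra mul gr.
Proof.
split.
- exact: Gamma_mul_linearl.
- exact: Gamma_mul_linearr.
- move=> i; split; first by case: i; apply/eqP.
  by case: i => k u v /eqP /= u0 /eqP /= v0; apply/eqP;
     rewrite /= u0 v0 scaler0 addr0.
- move=> v; exists ((v.1, 0), (0, v.2)); split=> [|[[a b] [c d]] []].
    split; [exact/eqP | exact/eqP |].
    by apply: Gamma_eqP; rewrite /= ?addr0 ?add0r.
  by move=> /eqP /= -> /eqP /= -> -> /=; rewrite addr0 add0r.
- exact: Gamma_mul_graded.
Qed.

Lemma Gamma_even_central v : v \in gr false -> in_center mul (gr false) v.
Proof.
move=> v0; split=> // [x _|x y x0 y0].
  by rewrite /commutator (Gamma_mulC_even x v0) subrr.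
by split; apply: Gamma_associator_even; rewrite v0 ?orbT.
Qed.

Lemma Gamma_square_even v : in_square mul (gr true) v -> v \in gr false.
Proof.
case=> s /allP s1 ->; have [_ _ sub _ _] := Gamma_is_superalgebra.
have [ev0 evD] := sub false.
rewrite big_seq; elim/big_rec: _ => // p w /s1 /andP[p1 p2] w0.
rewrite -[mul _ _]scale1r; apply: evD => //.
exact: (@Gamma_mul_graded true true).
Qed.

Lemma Gamma_is_Gamma_algebra : is_Gamma_algebra mul gr.
Proof.
split.
- exact: Gamma_is_superalgebra.
- exists (1, 0) => [|x x0]; first exact/eqP.
  rewrite -(Gamma_mulC_even x (x := (1, 0))); last exact/eqP.
  by split; apply: Gamma_eqP; rewrite /= /Gamma_det /=; ring.
- by move=> x y z x0 _ _; apply: Gamma_associator_even; rewrite x0.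
- by move=> x y x0 _; rewrite /commutator (Gamma_mulC_even y x0) subrr.
- by move=> x y z x0; apply: Gamma_associator_even; rewrite x0.
- by move=> v /Gamma_square_even /Gamma_even_central.
- move=> x y /Gamma_oddP x1 /Gamma_oddP y1.
  by apply: Gamma_eqP; rewrite /= /Gamma_det x1 y1; ring.
- move=> x y z /Gamma_oddP x1 /Gamma_oddP y1 /Gamma_oddP z1.
  by apply: Gamma_eqP; rewrite /= /Gamma_det /= x1 y1 z1; ring.
Qed.

Lemma Gamma_is_commutative_superalgebra : is_commutative_superalgebra mul gr.
Proof.
split; first exact: Gamma_is_superalgebra.
move=> [] [] x y xi yj; rewrite ?scale1r.
- apply/eqP; rewrite scaleN1r -addr_eq0; apply/eqP.
  exact: (Gamma_anticomm Gamma_is_Gamma_algebra).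
- by rewrite (Gamma_mulC_even x yj).
- exact: Gamma_mulC_even.
- exact: Gamma_mulC_even.
Qed.

(** After the expansion by [Gamma_associator_mull], the six summands are grouped
    by their coefficient [x.1], [y.1] or [t.1], and each of the three groups
    vanishes on its own. *)
Lemma Gamma_is_Jordan_superalgebra : is_Jordan_superalgebra mul gr.
Proof.
split; first exact: Gamma_is_commutative_superalgebra.
move=> i j k l x y z t xi yj zk tl.
(* The two associators of a group coincide by symmetry, so a group is
   [mul (c.1, 0) (assoc p z q)] times the sum of its two signs. The first
   factor is zero unless [c] is even and [p], [z], [q] are odd, and in that
   case the two signs cancel. *)
have bracket (m n o : bool) c p q (s s' : F) :
    c \in gr m -> p \in gr n -> q \in gr o ->
    [&& ~~ m, n, k & o] ==> (s + s' == 0) ->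
  s *: mul (c.1, 0) (assoc p z q) + s' *: mul (c.1, 0) (assoc q z p) = 0.
  move=> cm pn qo; rewrite (Gamma_associatorC q) -scalerDl.
  have Gmul0r (w : G) : mul (0, 0) w = 0.
    by apply: Gamma_eqP; rewrite /= /Gamma_det /=; ring.
  have Gmulr0 (w : G) : mul w 0 = 0.
    by apply: Gamma_eqP; rewrite /= /Gamma_det /=; ring.
  case: m cm => cm; first by rewrite (Gamma_oddP _ cm) Gmul0r scaler0.
  have [_ /eqP ->|odd3 _] := boolP [&& n, k & o]; first by rewrite scale0r.
  rewrite Gamma_associator_even ?Gmulr0 ?scaler0 //.
  case: n pn odd3 => [_|-> //]; case: (k) zk => [_|->]; last by rewrite orbT.
  by case: o qo => // ->; rewrite !orbT.
rewrite !Gamma_associator_mull !scalerDr.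
set s := (-1) ^+ (j * k + _ + _); set s' := (-1) ^+ (i * _ + _).
have sx : [&& ~~ i, j, k & l] ==> (1 + s == 0).
  by apply/implyP => /and4P[_ jT kT lT]; rewrite /s jT kT lT; apply/eqP; ring.
have sy : [&& ~~ j, i, k & l] ==> (1 + s' == 0).
  apply/implyP => /and4P[/negPf jF iT kT lT].
  by rewrite /s' jF iT kT lT; apply/eqP; ring.
have st : [&& ~~ l, i, k & j] ==> (s + s' == 0).
  apply/implyP => /and4P[/negPf lF iT kT jT].
  by rewrite /s /s' lF iT kT jT; apply/eqP; ring.
have := bracket _ _ _ _ _ _ _ _ xi yj tl sx; rewrite scale1r => x_bracket.
have := bracket _ _ _ _ _ _ _ _ yj xi tl sy; rewrite scale1r => y_bracket.
have t_bracket := bracket _ _ _ _ _ _ _ _ tl xi yj st.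
by rewrite [X in X + _]addrACA x_bracket add0r addrACA y_bracket add0r.
Qed.

End GammaTheory.

Theorem mainTheorem5 (F : fieldType) (A : comAlgType F) :
  is_Gamma_algebra (@Gamma_mul F A) (@Gamma_gr F A) /\
  is_Jordan_superalgebra (@Gamma_mul F A) (@Gamma_gr F A).
Proof.
split; [exact: Gamma_is_Gamma_algebra | exact: Gamma_is_Jordan_superalgebra].
Qed.
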